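(* Let $B\ge1$, let $W_1,\ldots,W_B$ be random variables with values in $\mathcal W\subset\mathbb R$ and $Z$ a random variable (or vector) with values in a measurable space $\mathcal Z$, all on a common probability space (with arbitrary joint distribution), and let $\psi:\mathcal Z\to\mathbb R$. Set $\delta=\Gamma(W_1,\ldots,W_B,\psi(Z))$. Then for any $0<\gamma,\beta<1$, $$\mathbb P\Big(\psi(Z)\in\big[W_{(\lfloor(B+1)(\gamma/2)\rfloor-1)},\,W_{(\lceil(B+1)(1-(\beta/2))\rceil)}\big]\Big)-\Big(1-\frac{\gamma+\beta}2\Big)\ge-\delta.$$ Here $W_{(r)}=\min\{w:w\in\mathcal W\}$ for $r\le0$ and $W_{(r)}=\max\{w:w\in\mathcal W\}$ for $r\ge B+1$. Additionally, if the distributions of the random variables $\psi(Z),W_1,\ldots,W_B$ are continuous, then $$\mathbb P\Big(\psi(Z)\in\big[W_{(\lfloor(B+1)(\gamma/2)\rfloor-1)},\,W_{(\lceil(B+1)(1-(\beta/2))\rceil)}\big]\Big)-\Big(1-\frac{\gamma+\beta}2\Big)\le\delta+\frac4{B+1}.$$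
   Context: $\mathcal W\subset\mathbb R$ is the space in which each $W_i$ takes its values, and $W_{(1)}\le\cdots\le W_{(B)}$ are the order statistics of $W_1,\ldots,W_B$. Let $V=(W_1,\ldots,W_B,\psi(Z))$; for $1\le i\le B$ let $V^i=(W_1,\ldots,W_{i-1},\psi(Z),W_{i+1},\ldots,W_B,W_i)$ be $V$ with $\psi(Z)$ and $W_i$ swapped, and let $V^{B+1}=V$. Then $$\Gamma(W_1,\ldots,W_B,\psi(Z))=\sup_A\Big|\mathbb P(V\in A)-\frac1{B+1}\sum_{i=1}^{B+1}\mathbb P(V^i\in A)\Big|,$$ the supremum being over all measurable sets $A$.
   Formalization: The lower bound additionally assumes ψ(Z) ∈ 𝒲 almost surely, and the upper bound additionally assumes P(ψ(Z)=W_i)=0 for each i; without these the claims fail (e.g. 𝒲={0}, ψ(Z)=1; or all W_i=ψ(Z) uniform). *)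

(* Defs.v *)
From mathcomp Require Export all_boot all_order all_algebra.
From mathcomp Require Export perm.
From mathcomp Require Export all_classical all_reals all_analysis.
Export Order.TTheory GRing.Theory Num.Theory.
Export numFieldNormedType.Exports.

Set Implicit Arguments.
Unset Strict Implicit.
Unset Printing Implicit Defensive.

Local Open Scope classical_set_scope.
Local Open Scope ring_scope.
Local Open Scope ereal_scope.

(* The vector (W_1, ..., W_B, Y): coordinate ord_max is Y, and coordinate
   j < B is W j. *)
Definition joint_vec (R : realType) (Omega : Type) (B : nat)
    (W : 'I_B -> Omega -> R) (Y : Omega -> R) (w : Omega) : B.+1.-tuple R :=
  [tuple if unlift ord_max j is Some i then W i w else Y w | j < B.+1].

(* Exchanges coordinates i and ord_max; the identity for i = ord_max. *)
Definition swap_last (T : Type) (B : nat) (i : 'I_B.+1) (v : B.+1.-tuple T) :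
    B.+1.-tuple T :=
  [tuple tnth v (tperm i ord_max j) | j < B.+1].

Definition Gamma (d : measure_display) (Omega : measurableType d)
    (R : realType) (P : probability Omega R) (B : nat)
    (W : 'I_B -> Omega -> R) (Y : Omega -> R) : \bar R :=
  let V := joint_vec W Y in
  ereal_sup [set `| P (V @^-1` A)
                    - (B.+1%:R^-1)%:E *
                      \sum_(i < B.+1) P ((swap_last i \o V) @^-1` A) |
            | A in [set A : set (B.+1.-tuple R) | measurable A]].

(* x_(r) for any integer r, with the conventions x_(r) = min Wspace for r <= 0
   and x_(r) = max Wspace for r >= B + 1. These extrema are taken in the
   extended reals, so that they exist for every Wspace (for instance, they are
   infinite for Wspace = R). *)
Definition order_stat (R : realType) (Wspace : set R) (B : nat) (x : 'I_B -> R)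
    (r : int) : \bar R :=
  if (r <= 0)%R then ereal_inf (EFin @` Wspace)
  else if (B%:Z < r)%R then ereal_sup (EFin @` Wspace)
  else (nth 0%R (sort <=%R (codom x)) `|r|%N.-1)%:E.

(* Y lies in [W_(floor((B+1) gamma/2) - 1), W_(ceil((B+1)(1 - beta/2)))]. *)
Definition coverage_event (R : realType) (Omega : Type) (Wspace : set R) (B : nat)
    (W : 'I_B -> Omega -> R) (Y : Omega -> R) (gamma beta : R) : set Omega :=
  [set w | order_stat Wspace (W ^~ w) (Num.floor (B.+1%:R * (gamma / 2)) - 1)%R
             <= (Y w)%:E
           <= order_stat Wspace (W ^~ w) (Num.ceil (B.+1%:R * (1 - beta / 2)))%R].

Definition continuous_distribution (d : measure_display)
    (Omega : measurableType d) (R : realType) (P : probability Omega R)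
    (X : {RV P >-> R}) : Prop :=
  continuous (cdf X : R -> \bar R).

(* Main.v *)
Require Import Defs.
From mathcomp Require Import measurable_realfun zify lra.

(** Up to events controlled by the hypotheses, coverage says that the counts
    #{j : V_j < V_(B+1)} and #{j : V_j <= V_(B+1)} of the vector V satisfy some
    condition Q.  Swapping coordinates i and B+1 replaces the rank of V_(B+1) by
    that of V_i, so the average of the swapped probabilities is the expected
    proportion of the indices i whose counts satisfy Q, which is bounded
    pointwise.  For the lower bound, at most (B+1) gamma/2 indices are too low
    and at most (B+1) beta/2 are too high, ties included.  For the upper bound,
    Q also requires V_i to be tied with no other coordinate: this costs nothing
    almost surely at the last coordinate, and the untied indices have distinct
    ranks even though the W_i may be tied with each other. *)

Set Implicit Arguments.
Unset Strict Implicit.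
Unset Printing Implicit Defensive.

Local Open Scope classical_set_scope.
Local Open Scope ring_scope.
Local Open Scope ereal_scope.

(** * Strict and weak counts, and how many indices can have extreme or untied ranks *)

Definition count_lt (R : realType) (J : finType) (x : J -> R) (y : R) : nat :=
  #|[set j | (x j < y)%R]%SET|.

Definition count_le (R : realType) (J : finType) (x : J -> R) (y : R) : nat :=
  #|[set j | (x j <= y)%R]%SET|.

Lemma count_lt_perm (R : realType) (J : finType) (x : J -> R) (s : {perm J}) (y : R) :
  count_lt (x \o s) y = count_lt x y.
Proof.
rewrite /count_lt -[RHS](card_preimset _ (@perm_inj _ s)).
by apply: eq_card => j; rewrite !inE.
Qed.

Lemma count_le_perm (R : realType) (J : finType) (x : J -> R) (s : {perm J}) (y : R) :
  count_le (x \o s) y = count_le x y.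
Proof.
rewrite /count_le -[RHS](card_preimset _ (@perm_inj _ s)).
by apply: eq_card => j; rewrite !inE.
Qed.

(** At an index [i] of the set where [x] is largest, [count_le x (x i)] counts every member of the
    set, ties included, and is itself at most [t]. *)
Lemma card_count_le_bound (R : realType) (J : finType) (x : J -> R) (t : R) :
  (0 <= t)%R ->
  (#|[set i | ((count_le x (x i))%:R <= t)%R]%SET|%:R <= t)%R.
Proof.
move=> t0; set S := [set i | _]%SET.
have [->|[i0 i0S]] := set_0Vmem S; first by rewrite cards0.
case: (@Order.TotalTheory.arg_maxP _ _ J i0 (fun j => j \in S) x i0S) => i iS imax.
have := iS; rewrite inE; apply: le_trans; rewrite ler_nat /count_le.
by apply/subset_leq_card/fintype.subsetP => j jS; rewrite inE; apply: imax.
Qed.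

(** Dually, take [i] in the set with [x i] smallest: the at least [t] indices lying strictly below
    it are all outside the set. *)
Lemma card_count_lt_bound (R : realType) (J : finType) (x : J -> R) (t : R) :
  (t <= #|J|%:R)%R ->
  (#|[set i | (t <= (count_lt x (x i))%:R)%R]%SET|%:R <= #|J|%:R - t)%R.
Proof.
move=> tJ; set S := [set i | _]%SET.
have [->|[i0 i0S]] := set_0Vmem S; first by rewrite cards0 subr_ge0.
case: (@Order.TotalTheory.arg_minP _ _ J i0 (fun j => j \in S) x i0S) => i iS imin.
rewrite lerBrDr -(cardsC S) natrD lerD2l.
have := iS; rewrite inE => /le_trans; apply; rewrite ler_nat /count_lt.
apply/subset_leq_card/fintype.subsetP => j; rewrite finset.in_set => ji; rewrite finset.in_setC.
by apply: contraL ji => jS; rewrite -leNgt; apply: imin.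
Qed.

Lemma count_le_eqE (R : realType) (J : finType) (x : J -> R) (y : R) :
  count_le x y = (count_lt x y + #|[set j | x j == y]%SET|)%N.
Proof.
rewrite /count_le /count_lt -cardsUI.
have -> : ([set j | (x j < y)%R] :&: [set j | x j == y])%SET = finset.set0.
  by apply/setP => j; rewrite !inE; case: ltgtP.
by rewrite cards0 addn0; apply: eq_card => j; rewrite !inE le_eqVlt orbC.
Qed.

(** Only [i] has to be untied. If [x i] and [x j] differ, the index of the smaller one is counted
    below the larger but not below itself, so the strict counts differ. *)
Lemma count_lt_untied_inj (R : realType) (J : finType) (x : J -> R) (i j : J) :
  count_le x (x i) = (count_lt x (x i)).+1 ->
  count_lt x (x i) = count_lt x (x j) -> i = j.
Proof.
move=> ti eij; case: (ltgtP (x i) (x j)) => [ltij|ltji|xij].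
- suff : (count_lt x (x i) < count_lt x (x j))%N by rewrite eij ltnn.
  apply/proper_card/fintype.properP; split.
    by apply/fintype.subsetP => k; rewrite !inE => /lt_trans; apply.
  by exists i; rewrite !inE ?ltxx.
- suff : (count_lt x (x j) < count_lt x (x i))%N by rewrite eij ltnn.
  apply/proper_card/fintype.properP; split.
    by apply/fintype.subsetP => k; rewrite !inE => /lt_trans; apply.
  by exists j; rewrite !inE ?ltxx.
(* The untied hypothesis makes the level set of [x i] a singleton, and it contains both [i] and
   [j]. *)
- move/eqP: ti; rewrite count_le_eqE -addn1 eqn_add2l => /cards1P[k ek].
  have : i \in [set k]%SET by rewrite -ek inE.
  have : j \in [set k]%SET by rewrite -ek inE xij.
  by rewrite !inE => /eqP -> /eqP ->.
Qed.

(** For untied indices [l < count_le] becomes [l <= count_lt], so [count_lt], shifted by [l], embeds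
    the set into the [u - l] integers from 0 to [u - l - 1]. *)
Lemma card_untied_bound (R : realType) (J : finType) (x : J -> R) (l u : int) :
  (l <= u)%R ->
  (#|[set i | [&& (l < count_le x (x i))%R, ((count_lt x (x i))%:Z < u)%R
     & count_le x (x i) == (count_lt x (x i)).+1]]%SET|%:R <= (u - l)%:~R :> R)%R.
Proof.
move=> lu; set S := [set i | _]%SET.
have -> : (u - l)%R = `|(u - l)%R|%N by lia.
rewrite -[(_%:~R)%R]/(_%:R)%R ler_nat.
pose f i : nat := `|(Posz (count_lt x (x i)) - l)%R|%N.
have lc i : i \in S -> (l <= count_lt x (x i))%R /\ ((count_lt x (x i))%:Z < u)%R.
  by rewrite inE => /and3P[lo hi /eqP e]; lia.
have : (size (map f (enum S)) <= size (iota 0 `|(u - l)%R|))%N.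
  apply: uniq_leq_size.
    rewrite map_inj_in_uniq ?enum_uniq// => i j.
    rewrite !mem_enum => iS jS; rewrite /f => fij.
    have [? ?] := lc _ iS; have [? ?] := lc _ jS.
    apply: (@count_lt_untied_inj _ _ x); last by lia.
    by move: iS; rewrite inE => /and3P[_ _ /eqP].
  move=> _ /mapP[i + ->]; rewrite mem_enum mem_iota => /lc [? ?].
  by rewrite /f; lia.
by rewrite size_map size_iota -cardE.
Qed.

(** * Order statistics expressed through counts *)

Lemma count_codom (T : Type) (J : finType) (x : J -> T) (p : pred T) :
  count p (codom x) = #|[set j | p (x j)]%SET|.
Proof.
rewrite count_map -size_filter cardE /enum_mem; congr (size _).
rewrite -filter_predI; apply: eq_filter => j.
by rewrite /= inE andbT.
Qed.

Lemma le_nth_sort (R : realType) (B : nat) (x : 'I_B -> R) (y : R) (r : nat) :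
  (0 < r <= B)%N ->
  (nth 0 (sort <=%R (codom x)) r.-1 <= y)%R = (r <= count_le x y)%N.
Proof.
move=> /andP[r0 rB].
have cE : count_le x y = count (<= y)%R (sort <=%R (codom x)).
  by rewrite count_sort count_codom.
have ss : sorted <=%R (sort <=%R (codom x)) by exact: sort_le_sorted.
rewrite cE; apply/idP/idP; last first.
  by move=> h; apply: nth_count_le => //; rewrite prednK.
apply: contraTT; rewrite -ltnNge -ltNge => h; apply: nth_count_gt => //.
by rewrite size_sort size_codom card_ord prednK// rB andbT -ltnS prednK.
Qed.

Lemma ge_nth_sort (R : realType) (B : nat) (x : 'I_B -> R) (y : R) (r : nat) :
  (0 < r <= B)%N ->
  (y <= nth 0 (sort <=%R (codom x)) r.-1)%R = (count_lt x y < r)%N.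
Proof.
move=> /andP[r0 rB].
have cE : count_lt x y = count (< y)%R (sort <=%R (codom x)).
  by rewrite count_sort count_codom.
have ss : sorted <=%R (sort <=%R (codom x)) by exact: sort_le_sorted.
rewrite cE; apply/idP/idP; last first.
  move=> h; apply: nth_count_ge => //.
  by rewrite size_sort size_codom card_ord prednK// rB andbT -ltnS prednK.
apply: contraTT; rewrite -leqNgt -ltNge => h; apply: nth_count_lt => //.
by rewrite prednK.
Qed.

(** For [r <= 0] the count condition is automatic and only the comparison with the infimum remains;
    [r <= B] rules out the supremum convention. *)
Lemma order_stat_le (R : realType) (Wspace : set R) (B : nat) (x : 'I_B -> R)
    (y : R) (r : int) : (r <= B%:Z)%R ->
  (order_stat Wspace x r <= y%:E) =
  (r <= count_le x y)%R && ((r <= 0)%R ==> (ereal_inf (EFin @` Wspace) <= y%:E)).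
Proof.
move=> rB; rewrite /order_stat; case: ifPn => r0 /=.
  by rewrite (le_trans r0).
rewrite ltNge rB /= andbT lee_fin le_nth_sort; lia.
Qed.

(** Mirror image: for [r] above [B] the count condition is automatic, a count over [B] indices being
    at most [B]. *)
Lemma order_stat_ge (R : realType) (Wspace : set R) (B : nat) (x : 'I_B -> R)
    (y : R) (r : int) : (0 < r)%R ->
  (y%:E <= order_stat Wspace x r) =
  ((count_lt x y)%:Z < r)%R && ((B%:Z < r)%R ==> (y%:E <= ereal_sup (EFin @` Wspace))).
Proof.
move=> r0; rewrite /order_stat [(r <= 0)%R]leNgt r0 /=; case: ifPn => rB /=.
  rewrite (le_lt_trans _ rB)// lez_nat /count_lt.
  by rewrite (leq_trans (max_card _))// card_ord.
rewrite andbT lee_fin ge_nth_sort; lia.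
Qed.

(** * Expected cardinalities and measurability of counting events *)

Lemma card_indicE (R : realType) (T : Type) (I : finType) (F : I -> T -> bool) (w : T) :
  (#|[set i | F i w]%SET|%:R)%:E = \sum_i (\1_[set w | F i w] w : R)%:E.
Proof.
rewrite sumEFin; congr (_%:E).
rewrite -sum1_card natr_sum big_mkcond; apply: eq_bigr => i _.
by rewrite indicE mem_setE inE unfold_in; case: (F i w).
Qed.

(** The sum is the integral of the number of indices [i] with [F i w], and [P] has total mass 1, so
    pointwise bounds on this number carry over. *)
Lemma sum_probability_bounds (d : measure_display) (Omega : measurableType d)
    (R : realType) (P : probability Omega R) (I : finType)
    (F : I -> Omega -> bool) (a b : R) :
  (forall i, measurable [set w | F i w]) -> (0 <= a)%R ->
  (forall w, a <= #|[set i | F i w]%SET|%:R <= b)%R ->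
  a%:E <= \sum_i P [set w | F i w] <= b%:E.
Proof.
move=> mF a0 abF.
have m1 i : measurable_fun setT (fun w => (\1_[set w | F i w] w : R)%:E).
  by apply/measurable_EFinP; exact: measurable_indic.
have -> : \sum_i P [set w | F i w] =
    \int[P]_w \sum_i (\1_[set w | F i w] w : R)%:E.
  rewrite ge0_integral_sum//.
  by apply: eq_bigr => i _; rewrite integral_indic// setIT.
have cstP r : r%:E = \int[P]_w (cst r%:E) w.
  by rewrite integral_cst// -[LHS]mule1; congr (_ * _); exact/esym/probability_setT.
have ms : measurable_fun setT (fun w => \sum_i (\1_[set w | F i w] w : R)%:E).
  exact: emeasurable_sum.
rewrite (cstP a) (cstP b); apply/andP; split; apply: ge0_le_integral => //= w _.
- by rewrite -card_indicE lee_fin; case/andP: (abF w).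
- by rewrite -card_indicE lee_fin.
- by rewrite -card_indicE lee_fin; case/andP: (abF w).
Qed.

(** The event is a finite union over the possible pairs of index sets, and fixing such a set is a
    finite intersection of measurable events. *)
Lemma measurable_card_pred (d : measure_display) (T : measurableType d)
    (J : finType) (b c : J -> T -> bool) (Q : nat -> nat -> bool) :
  (forall j, measurable_fun setT (b j)) ->
  (forall j, measurable_fun setT (c j)) ->
  measurable [set w | Q #|[set j | b j w]%SET| #|[set j | c j w]%SET|].
Proof.
move=> mb mc.
have mS (e : J -> T -> bool) (S : {set J}) : (forall j, measurable_fun setT (e j)) ->
    measurable [set w | [set j | e j w]%SET = S].
  move=> me; rewrite [X in measurable X](_ : _ =
      \bigcap_(j in setT) (e j @^-1` [set j \in S])); last first.
    apply/seteqP; split=> w /=.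
      by move=> <- j _ /=; rewrite inE.
    by move=> H; apply/setP => j; rewrite inE; apply: H.
  apply: fin_bigcap_measurable; first exact: finite_finset.
  by move=> j _; rewrite -[_ @^-1` _]setTI; apply: me.
rewrite [X in measurable X](_ : _ =
  \bigcup_(S in [set S : {set J} * {set J} | Q #|S.1| #|S.2|])
    ([set w | [set j | b j w]%SET = S.1] `&` [set w | [set j | c j w]%SET = S.2])).
  apply: fin_bigcup_measurable; first exact: finite_finset.
  by move=> S _; apply: measurableI; exact: mS.
apply/seteqP; split=> w /=; last by case=> -[S1 S2] /= h [-> ->].
by move=> h; exists ([set j | b j w]%SET, [set j | c j w]%SET).
Qed.

Lemma measurable_count_pred (d : measure_display) (T : measurableType d)
    (R : realType) (J : finType) (f : J -> T -> R) (y : T -> R) (Q : nat -> nat -> bool) :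
  (forall j, measurable_fun setT (f j)) -> measurable_fun setT y ->
  measurable [set w | Q (count_lt (f ^~ w) (y w)) (count_le (f ^~ w) (y w))].
Proof.
move=> mf my; apply: measurable_card_pred => j.
  exact: measurable_fun_ltr.
exact: measurable_fun_ler.
Qed.

(** * Rank conditions under swaps, and their control by [Gamma] *)

Definition rank_pred (R : realType) (n : nat) (Q : nat -> nat -> bool)
    (x : 'I_n -> R) (i : 'I_n) : bool :=
  Q (count_lt x (x i)) (count_le x (x i)).

(** Counts are invariant under permutations, and the swap brings coordinate [i] to the last
    place. *)
Lemma rank_pred_swap (R : realType) (B : nat) (Q : nat -> nat -> bool)
    (v : B.+1.-tuple R) (i : 'I_B.+1) :
  rank_pred Q (tnth (swap_last i v)) ord_max = rank_pred Q (tnth v) i.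
Proof.
have -> : tnth (swap_last i v) = tnth v \o tperm i ord_max.
  by apply/funext => j; rewrite tnth_mktuple.
by rewrite /rank_pred count_lt_perm count_le_perm /= tpermR.
Qed.

Lemma measurable_rank_pred (d : measure_display) (T : measurableType d)
    (R : realType) (n : nat) (V : T -> n.-tuple R) (Q : nat -> nat -> bool)
    (i : 'I_n) :
  measurable_fun setT V -> measurable [set w | rank_pred Q (tnth (V w)) i].
Proof.
move/measurable_fun_tnthP => mV.
exact: (@measurable_count_pred _ T R _ (fun j w => tnth (V w) j)
  (fun w => tnth (V w) i) Q mV (mV i)).
Qed.

Lemma measurable_joint_vec (d : measure_display) (T : measurableType d)
    (R : realType) (B : nat) (W : 'I_B -> T -> R) (Y : T -> R) :
  (forall i, measurable_fun setT (W i)) -> measurable_fun setT Y ->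
  measurable_fun setT (joint_vec W Y).
Proof.
move=> mW mY; apply/measurable_fun_tnthP => j.
rewrite (_ : _ \o _ = fun w => if unlift ord_max j is Some i then W i w else Y w).
  by case: unlift.
by apply/funext => w; rewrite /= tnth_mktuple.
Qed.

(** The supremum in [Gamma] is tested on the set of vectors whose last coordinate satisfies the rank
    condition. The swapped average is then the expected number of indices satisfying it, divided by
    [B.+1]. *)
Lemma Gamma_rank_bounds (d : measure_display) (Omega : measurableType d)
    (R : realType) (P : probability Omega R) (B : nat)
    (W : 'I_B -> Omega -> R) (Y : Omega -> R) (Q : nat -> nat -> bool)
    (a b : R) :
  (forall i, measurable_fun setT (W i)) -> measurable_fun setT Y -> (0 <= a)%R ->
  (forall x : 'I_B.+1 -> R, a <= #|[set i | rank_pred Q x i]%SET|%:R <= b)%R ->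
  (a / B.+1%:R)%:E - Gamma P W Y
    <= P [set w | rank_pred Q (tnth (joint_vec W Y w)) ord_max]
    <= (b / B.+1%:R)%:E + Gamma P W Y.
Proof.
move=> mW mY a0 abQ; set V := joint_vec W Y.
have mV : measurable_fun setT V by exact: measurable_joint_vec.
pose A : set (B.+1.-tuple R) := [set v | rank_pred Q (tnth v) ord_max].
have mA : measurable A by apply: measurable_rank_pred; exact: measurable_id.
have PV : P (V @^-1` A) = P [set w | rank_pred Q (tnth (V w)) ord_max] by [].
have Gle : `| P (V @^-1` A) - (B.+1%:R^-1)%:E *
    \sum_(i < B.+1) P ((swap_last i \o V) @^-1` A) | <= Gamma P W Y.
  by apply: ereal_sup_ubound; exists A.
have sE : \sum_(i < B.+1) P ((swap_last i \o V) @^-1` A) =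
    \sum_(i < B.+1) P [set w | rank_pred Q (tnth (V w)) i].
  apply: eq_bigr => i _; congr (P _); apply/seteqP.
  by split=> w /=; rewrite /A /= rank_pred_swap.
have := @sum_probability_bounds _ _ _ P _ (fun i w => rank_pred Q (tnth (V w)) i) a b
  (fun i => measurable_rank_pred Q i mV) a0 (fun w => abQ _).
move: Gle; rewrite -PV sE.
set s := \sum_(_ < _) _.
have Pfin : P (V @^-1` A) \is a fin_num by apply: fin_num_measure; rewrite -[_ @^-1` _]setTI; exact: mV.
have n0 : (0 < B.+1%:R^-1 :> R)%R by rewrite invr_gt0.
(* [Gamma] cannot be [-oo] since it bounds an absolute value, and [+oo] makes both inequalities
   trivial. *)
rewrite -(fineK Pfin); case: (Gamma P W Y) => [g||] /=; first last.
- by move=> /(le_trans (abse_ge0 _)).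
- by move=> _ _; rewrite leNye leey.
move=> + /andP[]; case: s => [s||] //= +.
rewrite !lee_fin => + sa sb => /ler_normlP[h1 h2].
move: (ler_wpM2r (ltW n0) sa) (ler_wpM2r (ltW n0) sb).
move: h1 h2; rewrite [(_^-1 * s)%R]mulrC.
move: (fine _) (s / _)%R (a / _)%R (b / _)%R => p s' a' b' h1 h2 h3 h4.
by apply/andP; split; lra.
Qed.

(** * The coverage event as a rank condition on the joint vector *)

Lemma card_pred_recr (B : nat) (p : pred 'I_B.+1) :
  #|[set j | p j]%SET| = (p ord_max + #|[set i | p (lift ord_max i)]%SET|)%N.
Proof.
rewrite -!sum1dep_card big_mkcond (bigD1_ord ord_max) //= [in RHS]big_mkcond.
by case: (p ord_max).
Qed.

Lemma count_lt_joint_vec (R : realType) (Omega : Type) (B : nat)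
    (W : 'I_B -> Omega -> R) (Y : Omega -> R) (w : Omega) (y : R) :
  count_lt (tnth (joint_vec W Y w)) y = ((Y w < y)%R + count_lt (W ^~ w) y)%N.
Proof.
rewrite /count_lt card_pred_recr tnth_mktuple unlift_none; congr (_ + _)%N.
by apply: eq_card => i; rewrite !inE tnth_mktuple liftK.
Qed.

Lemma count_le_joint_vec (R : realType) (Omega : Type) (B : nat)
    (W : 'I_B -> Omega -> R) (Y : Omega -> R) (w : Omega) (y : R) :
  count_le (tnth (joint_vec W Y w)) y = ((Y w <= y)%R + count_le (W ^~ w) y)%N.
Proof.
rewrite /count_le card_pred_recr tnth_mktuple unlift_none; congr (_ + _)%N.
by apply: eq_card => i; rewrite !inE tnth_mktuple liftK.
Qed.

(** The inequality on the weak count [b] is strict because, over the full vector, a coordinate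
    counts itself. *)
Definition rank_between (l u : int) (a b : nat) : bool :=
  (l < b%:Z)%R && (a%:Z < u)%R.

(** What the conventions for ranks outside 1 to [B] demand of [Y] beyond its rank. *)
Definition in_range (R : realType) (Wspace : set R) (B : nat) (l u : int) : set R :=
  [set y | ((l <= 0)%R ==> (ereal_inf (EFin @` Wspace) <= y%:E)) &&
           ((B%:Z < u)%R ==> (y%:E <= ereal_sup (EFin @` Wspace)))].

Lemma in_range_mem (R : realType) (Wspace : set R) (B : nat) (l u : int) :
  Wspace `<=` in_range Wspace B l u.
Proof.
move=> y Wy; apply/andP; split; apply/implyP => _.
  by apply: ereal_inf_lbound; exists y.
by apply: ereal_sup_ubound; exists y.
Qed.

(** [Wspace] is arbitrary, but only its extrema enter, so the set is an interval. *)
Lemma measurable_in_range (R : realType) (Wspace : set R) (B : nat) (l u : int) :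
  measurable (in_range Wspace B l u).
Proof.
apply: is_interval_measurable => x y /andP[lx _] /andP[_ yu] z /andP[xz zy].
apply/andP; split; apply/implyP => h.
  by apply: le_trans (implyP lx h) _; rewrite lee_fin.
by apply: le_trans (implyP yu h); rewrite lee_fin.
Qed.

Lemma order_stat_betweenE (R : realType) (Omega : Type) (Wspace : set R) (B : nat)
    (W : 'I_B -> Omega -> R) (Y : Omega -> R) (l u : int) :
  (l <= B%:Z)%R -> (0 < u)%R ->
  [set w | order_stat Wspace (W ^~ w) l <= (Y w)%:E <= order_stat Wspace (W ^~ w) u] =
  [set w | rank_pred (rank_between l u) (tnth (joint_vec W Y w)) ord_max] `&`
  Y @^-1` in_range Wspace B l u.
Proof.
move=> lB u0; apply/seteqP.
suff H w : (order_stat Wspace (W ^~ w) l <= (Y w)%:E <= order_stat Wspace (W ^~ w) u) =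
    rank_pred (rank_between l u) (tnth (joint_vec W Y w)) ord_max &&
    (((l <= 0)%R ==> (ereal_inf (EFin @` Wspace) <= (Y w)%:E)) &&
    ((B%:Z < u)%R ==> ((Y w)%:E <= ereal_sup (EFin @` Wspace)))).
  by split=> w /=; rewrite H => /andP.
rewrite order_stat_le// order_stat_ge//.
rewrite /rank_pred /rank_between count_lt_joint_vec count_le_joint_vec.
rewrite tnth_mktuple unlift_none ltxx lexx add0n.
rewrite (_ : (l < _)%R = (l <= count_le (W ^~ w) (Y w))%R); last by lia.
by rewrite -!andbA; congr (_ && _); rewrite andbCA.
Qed.

(** * Almost sure comparison of events and the two coverage bounds *)

Lemma ae_subset_le_measure (d : measure_display) (T : measurableType d)
    (R : realType) (mu : {measure set T -> \bar R}) (A C : set T) :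
  measurable A -> measurable C -> {ae mu, forall w, A w -> C w} -> mu A <= mu C.
Proof.
move=> mA mC [N [mN N0 sN]].
rewrite -(measureU0 mC mN N0); apply: le_measure; rewrite ?inE//.
  exact: measurableU.
move=> w Aw; have [Cw|nCw] := pselect (C w); first by left.
by right; apply: sN => /(_ Aw).
Qed.

(** A failing index has weak count at most [l <= s] or strict count at least [u >= t]. There are at
    most [s] of the first kind and [B.+1 - t] of the second. *)
Lemma card_rank_between_ge (R : realType) (B : nat) (s t : R) (l u : int)
    (x : 'I_B.+1 -> R) :
  (0 <= s)%R -> (t <= B.+1%:R)%R -> (l%:~R <= s)%R -> (t <= u%:~R)%R ->
  (t - s <= #|[set i | rank_pred (rank_between l u) x i]%SET|%:R)%R.
Proof.
move=> s0 tB ls tu.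
have h1 := card_count_le_bound x s0.
have := @card_count_lt_bound _ _ x t; rewrite card_ord => /(_ tB) h2.
set A := [set i | _]%SET in h1; set C := [set i | _]%SET in h2.
set G := [set i | _]%SET.
have /subset_leq_card : [set: 'I_B.+1]%SET \subset (G :|: (A :|: C))%SET.
  apply/fintype.subsetP => i _; rewrite !inE /rank_pred /rank_between.
  case: ltP => [_|lel] /=; last first.
    apply/orP; left; apply: le_trans ls.
    by rewrite -(ler_int R) in lel.
  case: ltP => [//|leu] /=; apply/orP; right; apply: (le_trans tu).
  by rewrite -(ler_int R) in leu.
rewrite cardsT card_ord => h3.
have h4 : (#|G :|: (A :|: C)| <= #|G| + (#|A| + #|C|))%N.
  by apply: (leq_trans (leq_card_setU _ _)); rewrite leq_add2l leq_card_setU.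
have := leq_trans h3 h4; rewrite -(ler_nat R) !natrD => h5.
move: h1 h2 h5; lra.
Qed.

Theorem theorem4 (R : realType) (d : measure_display)
    (Omega : measurableType d) (P : probability Omega R)
    (dZ : measure_display) (TZ : measurableType dZ)
    (B : nat) (hB : (1 <= B)%N)
    (Wspace : set R) (W : 'I_B -> {RV P >-> R})
    (hW : forall (i : 'I_B) (w : Omega), Wspace (W i w))
    (Z : {RV P >-> TZ}) (psi : {mfun TZ >-> R})
    (gamma beta : R) (hgamma : (0 < gamma < 1)%R) (hbeta : (0 < beta < 1)%R) :
  let delta := Gamma P W (psi \o Z) in
  let E := coverage_event Wspace W (psi \o Z) gamma beta in
  ({ae P, forall w, Wspace (psi (Z w))} ->
    P E - (1 - (gamma + beta) / 2)%:E >= - delta)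
  /\
  (continuous_distribution (psi \o Z : {RV P >-> R}) ->
   (forall i : 'I_B, continuous_distribution (W i)) ->
   (forall i : 'I_B, P [set w | psi (Z w) = W i w] = 0) ->
    P E - (1 - (gamma + beta) / 2)%:E <= delta + (4 / B.+1%:R)%:E).
Proof.
move=> delta E.
set Y : Omega -> R := psi \o Z.
have mY : measurable_fun setT Y by exact: measurableT_comp.
have mW i : measurable_fun setT (W i) by [].
pose N : R := B.+1%:R.
have N2 : (2 <= N)%R by rewrite /N (ler_nat R 2).
pose l : int := (Num.floor (N * (gamma / 2)) - 1)%R.
pose u : int := Num.ceil (N * (1 - beta / 2))%R.
have [g0 g1] := andP hgamma; have [b0 b1] := andP hbeta.
have /andP[l_ub l_lb] : (N * (gamma / 2) - 2 < l%:~R <= N * (gamma / 2) - 1)%R.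
  by have := floor_itv (N * (gamma / 2)); rewrite /l intrB intrD; lra.
have /andP[u_lb u_ub] : (N * (1 - beta / 2) <= u%:~R < N * (1 - beta / 2) + 1)%R.
  by have := ceil_itv (N * (1 - beta / 2)); rewrite intrB /u; lra.
(* As [gamma] and [beta] are below 1, the level [N / 2] separates the two endpoints; this yields
   [0 < u], [l <= u] and [l <= B]. *)
have Ngamma : (0 <= N * (gamma / 2) <= N / 2)%R by apply/andP; split; nra.
have Nbeta : (N / 2 <= N * (1 - beta / 2) <= N)%R by apply/andP; split; nra.
have u0 : (0 < u)%R by rewrite -(ltr_int R); lra.
have lu : (l <= u)%R by rewrite -(ler_int R); lra.
have lB : (l <= B%:Z)%R.
  by rewrite -(ler_int R); move: l_ub Ngamma; rewrite /N -natr1; lra.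
pose A := [set w | rank_pred (rank_between l u) (tnth (joint_vec W Y w)) ord_max].
have mV : measurable_fun setT (joint_vec W Y) by exact: measurable_joint_vec.
have mA : measurable A by exact: measurable_rank_pred.
have EA : E = A `&` Y @^-1` in_range Wspace B l u.
  exact: (@order_stat_betweenE _ _ Wspace _ W Y _ _ lB u0).
have mE : measurable E.
  rewrite EA; apply: measurableI => //; rewrite -[_ @^-1` _]setTI.
  by apply: mY => //; exact: measurable_in_range.
have PEfin : P E \is a fin_num by exact: fin_num_measure.
have NV : (N / N = 1)%R by rewrite divff// lt0r_neq0//; lra.
split.
  move=> aeY.
  (* Almost surely [Y] lies in [Wspace], where the range conditions hold, so the rank condition
     alone gives coverage. *)
  have PAE : P A <= P E.
    apply: ae_subset_le_measure => //; rewrite EA.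
    by apply: filterS aeY => w WY Aw; split => //; exact: in_range_mem.
  have := @Gamma_rank_bounds _ _ _ P _ W Y (rank_between l u)
    (N * (1 - beta / 2) - N * (gamma / 2)) N mW mY.
  have -> : ((N * (1 - beta / 2) - N * (gamma / 2)) / N = 1 - (gamma + beta) / 2)%R.
    by rewrite -mulrBr mulrAC NV; lra.
  case/(_ _ _)/andP.
  - lra.
  - move=> x; apply/andP; split.
      by apply: card_rank_between_ge => //; lra.
    by rewrite ler_nat -[leqRHS](card_ord B.+1) max_card.
  move=> /le_trans/(_ PAE) + _; rewrite -/delta -(fineK PEfin).
  case: delta => [g||] //=; rewrite ?lee_fin; last by move=> _; rewrite leNye.
  by move: (fine _) => p; lra.
move=> _ _ tie0.
(* [b == a.+1] says that the coordinate is tied only with itself. *)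
pose Q a b := rank_between l u a b && (b == a.+1).
pose A' := [set w | rank_pred Q (tnth (joint_vec W Y w)) ord_max].
(* Coverage implies the rank condition, and [tie0], applied to the finitely many [i], makes the last
   coordinate untied almost surely. *)
have PEA' : P E <= P A'.
  apply: ae_subset_le_measure => //; first exact: measurable_rank_pred.
  have : {ae P, forall w, forall i, psi (Z w) <> W i w}.
    apply: filter_forall => i.
    exists [set w | psi (Z w) = W i w]; split => //; last by move=> w /contrapT.
    rewrite (_ : mkset _ = [set w | Y w == W i w]).
      rewrite -[X in measurable X]setTI.
      by apply: (measurable_fun_eqr mY (mW i) measurableT (Y := [set true])).
    by apply/seteqP; split=> w /eqP.
  apply: filterS => w untied; rewrite EA => -[Aw _]; apply/andP; split => //.
  rewrite count_le_joint_vec count_lt_joint_vec tnth_mktuple unlift_none ltxx lexx.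
  rewrite count_le_eqE; set T := [set i | _]%SET.
  suff -> : T = finset.set0 by rewrite cards0 addn0.
  by apply/setP => i; rewrite !inE; apply/eqP => /esym/untied.
have := @Gamma_rank_bounds _ _ _ P _ W Y Q 0 (u - l)%:~R mW mY (lexx _).
case/(_ _)/andP.
  move=> x; rewrite ler0n /=; apply: le_trans (card_untied_bound x lu).
  rewrite ler_nat; apply/subset_leq_card/fintype.subsetP => i.
  by rewrite !inE /rank_pred /Q /rank_between -andbA.
move=> _ /(le_trans PEA'); rewrite -/delta -(fineK PEfin).
(* The ceiling adds less than 1 and the shifted floor less than 2, so rounding costs less than 3,
   within the 4 of the statement. *)
have ul : ((u - l)%:~R / N <= (1 - (gamma + beta) / 2) + 4 / N)%R.
  have -> : (1 - (gamma + beta) / 2 + 4 / N = (N * (1 - (gamma + beta) / 2) + 4) / N)%R.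
    by rewrite [RHS]mulrDl mulrAC NV mul1r.
  rewrite ler_pM2r ?invr_gt0; last lra.
  by rewrite intrB; lra.
case: delta => [g||] //=; rewrite ?lee_fin; last by rewrite addye ?leey.
move: (fine _) ul => p; rewrite /N; move: (_ / _)%R (4 / _)%R => b f; lra.
Qed.
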